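(* There is an additive chores instance for which no PMMS allocation exists. Likewise, there is an additive goods instance for which no PMMS allocation exists.
   Context: $N=[n]=\{1,\dots,n\}$ is a finite set of agents and $M$ a finite set of indivisible items. An allocation $X=(X_i)_{i\in N}$ is a partition of $M$ into $n$ (possibly empty) bundles indexed by agents. $\Pi_2(S)$ is the set of ordered bipartitions $(P_1,P_2)$ of a bundle $S\subseteq M$ (parts may be empty). Additive goods instance: each agent $i$ has an additive valuation $v_i:2^{M}\to\mathbb{R}_{\ge0}$ (the value of a bundle is the sum of the values of its items). An allocation $X$ is PMMS (pairwise maximin share) for goods if for all $i\neq j$, $v_i(X_i)\ge \max_{(P_1,P_2)\in\Pi_2(X_i\cup X_j)}\min\{v_i(P_1),v_i(P_2)\}$. Additive chores instance: each agent $i$ has an additive cost function $c_i:2^{M}\to\mathbb{R}_{\ge0}$. An allocation $X$ is PMMS for chores if for all $i\ne j$, $c_i(X_i)\le \min_{(P_1,P_2)\in\Pi_2(X_i\cup X_j)}\max\{c_i(P_1),c_i(P_2)\}$. *)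

(* Defs.v *)
From HB Require Import structures.
From mathcomp Require Import all_boot all_order all_algebra.
From mathcomp Require Import reals.

Set Implicit Arguments.
Unset Strict Implicit.
Unset Printing Implicit Defensive.

Import Order.TTheory GRing.Theory Num.Theory.
Local Open Scope ring_scope.

(* Nonnegative and additive set function: the valuation or the cost of a
   single agent. *)
Definition additive_valuation (R : realType) (M : finType) (f : {set M} -> R) :=
  (forall S : {set M}, 0 <= f S) /\
  (forall S : {set M}, f S = \sum_(x in S) f [set x]).

(* [0 < n] excludes the degenerate case of an empty set of agents, for which
   a nonempty set of items has no allocation at all. *)
Definition additive_instance (R : realType) (n : nat) (M : finType)
    (f : 'I_n -> {set M} -> R) :=
  (0 < n)%N /\ (forall i : 'I_n, additive_valuation (f i)).

(* [partition] of finset cannot be used: bundles are indexed and may be empty. *)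
Definition allocation (n : nat) (M : finType) (X : 'I_n -> {set M}) :=
  (forall i j : 'I_n, i != j -> [disjoint X i & X j]) /\
  \bigcup_(i < n) X i = [set: M].

Definition bipartitions (M : finType) (S : {set M}) : {set {set M} * {set M}} :=
  [set P | (P.1 :|: P.2 == S) && [disjoint P.1 & P.2]].

(* In the two shares below, the initial value of the iterated max (resp. min)
   is the term at (S, set0), an element of [bipartitions S], so the result is
   the exact maximum (resp. minimum) over [bipartitions S]. *)
Definition maximin_share (R : realType) (M : finType) (v : {set M} -> R)
    (S : {set M}) : R :=
  \big[Num.max/Num.min (v S) (v set0)]_(P in bipartitions S)
    Num.min (v P.1) (v P.2).

Definition minimax_share (R : realType) (M : finType) (c : {set M} -> R)
    (S : {set M}) : R :=
  \big[Num.min/Num.max (c S) (c set0)]_(P in bipartitions S)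
    Num.max (c P.1) (c P.2).

Definition PMMS_goods (R : realType) (n : nat) (M : finType)
    (v : 'I_n -> {set M} -> R) (X : 'I_n -> {set M}) :=
  forall i j : 'I_n, i != j -> maximin_share (v i) (X i :|: X j) <= v i (X i).

Definition PMMS_chores (R : realType) (n : nat) (M : finType)
    (c : 'I_n -> {set M} -> R) (X : 'I_n -> {set M}) :=
  forall i j : 'I_n, i != j -> c i (X i) <= minimax_share (c i) (X i :|: X j).

(* Main.v *)
From Stdlib Require Import NArith Lia.
Require Import Defs.
From HB Require Import structures.
From mathcomp Require Import all_boot all_order all_algebra.
From mathcomp Require Import reals.

Set Implicit Arguments.
Unset Strict Implicit.
Unset Printing Implicit Defensive.

Import Order.TTheory GRing.Theory Num.Theory.
Local Open Scope ring_scope.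

(** Both instances have three agents, six large items 0..5 and three small items
6, 7, 8; agent [i] assigns to the items the values [400 + e i k] (large) and
[60 + e i k] (small) in the goods instance, and the costs [400 - e i k] and
[60 - e i k] in the chores instance, for the small perturbation [e] below (found
by computer search). The base weights force every agent to own exactly two large
items and one small item: otherwise moving a single item between two bundles
improves both sides of the bipartition for one of their owners. In each of the
540 remaining allocations the perturbation leaves some agent who can improve
both sides by exchanging items of equal size between its bundle and another. *)

Definition perturbation : seq (seq N) :=
  [:: [:: 0; 9; 10; 5; 12; 7; 10; 4; 0];
      [:: 11; 24; 19; 0; 20; 14; 2; 0; 1];
      [:: 1; 10; 3; 0; 5; 2; 11; 0; 5]]%num.

(** Binary numbers keep the evaluation fast. Truncated subtraction is exact here: perturbations are
    at most 24, below both base weights. *)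
Definition weight (goods : bool) (i k : nat) : N :=
  let base := if (k < 6)%N then 400%num else 60%num in
  let e := nth 0%num (nth [::] perturbation i) k in
  if goods then N.add base e else N.sub base e.

Definition sum_weight (goods : bool) (i : nat) (p : pred nat) : N :=
  foldr (fun k s => if p k then N.add (weight goods i k) s else s) 0%num
    (iota 0 9).

(* An allocation is coded by the word [l] whose [k]-th letter is the owner of
   item [k]. *)
Definition owns (l : seq nat) (i k : nat) : bool := nth 3 l k == i.

(* The two sides ([b] = true, false) of the bipartition of the union of bundles
   [i] and [j] obtained by letting the items of [D] change sides. *)
Definition side (l : seq nat) (i j : nat) (D : seq nat) (b : bool) : pred nat :=
  fun k => if owns l i k then (k \in D) != b
           else if owns l j k then (k \in D) == b else false.

Definition better (goods : bool) (a b : N) : bool :=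
  if goods then N.ltb a b else N.ltb b a.

Definition improves (goods : bool) (l : seq nat) (i j : nat) (D : seq nat) :=
  let a := sum_weight goods i (owns l i) in
  if better goods a (sum_weight goods i (side l i j D true))
  then better goods a (sum_weight goods i (side l i j D false)) else false.

(* [has], but [vm_compute] stops at the first success: [||] is strict there. *)
Fixpoint some (T : Type) (a : pred T) (s : seq T) : bool :=
  if s is x :: s' then if a x then true else some a s' else false.

Lemma some_has (T : Type) (a : pred T) (s : seq T) : some a s = has a s.
Proof. by elim: s => //= x s ->; case: (a x). Qed.

(** For bundles of two large items and one small item, the five exchanges give, up to swapping
    sides, every other bipartition of this shape. In a single transfer agent [i] gains a good or
    sheds a chore, so its own side improves at once. Bundles are listed in increasing order: [head]
    picks a large item if there is one, [last] a small one. The default 9 is no item, so an empty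
    giver moves nothing. *)
Definition transfers (goods : bool) (b c : seq nat) : seq (seq nat) :=
  let exchanges := if (b, c) is ([:: x1; x2; x3], [:: y1; y2; y3]) then
    [:: [:: x3; y3]; [:: x1; y1]; [:: x1; y2]; [:: x1; x3; y1; y3];
        [:: x1; x3; y2; y3]] else [::] in
  let giver := if goods then c else b in
  exchanges ++ [:: [:: head 9 giver]; [:: last 9 giver]].

Definition blocked (goods : bool) (l : seq nat) : bool :=
  some (fun ij => some (improves goods l ij.1 ij.2)
         (transfers goods (filter (owns l ij.1) (iota 0 9))
                          (filter (owns l ij.2) (iota 0 9))))
    [:: (0, 1); (0, 2); (1, 0); (1, 2); (2, 0); (2, 1)]%N.

(** Passing the predicate down avoids building the list of all [3 ^ n] words. *)
Fixpoint all_words (n : nat) (P : pred (seq nat)) : bool :=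
  if n is n'.+1 then all (fun o => all_words n' (fun l => P (o :: l))) (iota 0 3)
  else P [::].

Lemma all_wordsP (n : nat) (P : pred (seq nat)) (l : seq nat) :
  all_words n P -> size l = n -> all (ltn^~ 3) l -> P l.
Proof.
elim: n P l => [|n IHn] P [|o l] //= /and4P[H0 H1 H2 _] [sz] /andP[o3 l3].
by case: o o3 => [|[|[|o]]] // _;
  [move: H0|move: H1|move: H2] => /IHn; apply.
Qed.

Lemma all_blocked (goods : bool) : all_words 9 (blocked goods).
Proof. by case: goods; vm_compute. Qed.

Lemma to_nat_lt (a b : N) : N.ltb a b -> (N.to_nat a < N.to_nat b)%N.
Proof. by move=> /N.ltb_lt ab; apply/ssrnat.ltP; lia. Qed.

Definition value (R : realType) (goods : bool) (i : 'I_3) (S : {set 'I_9}) : R :=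
  \sum_(x in S) (N.to_nat (weight goods i x))%:R.

Lemma value_additive (R : realType) (goods : bool) (i : 'I_3) :
  additive_valuation (@value R goods i).
Proof.
split=> S; first by apply: sumr_ge0 => x _; apply: ler0n.
by apply: eq_bigr => x _; rewrite /value big_set1.
Qed.

Lemma value_sum_weight (R : realType) (goods : bool) (i : 'I_3)
    (S : {set 'I_9}) (p : pred nat) :
  (forall x : 'I_9, (x \in S) = p x) ->
  value R goods i S = (N.to_nat (sum_weight goods i p))%:R.
Proof.
move=> Sp; rewrite /value (eq_bigl _ _ Sp).
rewrite -(big_mkord p (fun k => (N.to_nat (weight goods i k))%:R)).
rewrite /index_iota subn0 /sum_weight.
elim: (iota 0 9) => [|k r IHr]; first by rewrite big_nil.
by rewrite big_cons IHr /=; case: (p k); rewrite // N2Nat.inj_add natrD.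
Qed.

Definition strictly_better (R : realType) (goods : bool) (a b : R) :=
  if goods then a < b else b < a.

(** The word of owners of [X] is among the [3 ^ 9] words checked by evaluation; the transfer found
    there is carried back to sets and real values. *)
Lemma improving_bipartition (R : realType) (goods : bool)
    (X : 'I_3 -> {set 'I_9}) :
  allocation X ->
  exists i j : 'I_3, i != j /\ exists2 P, P \in bipartitions (X i :|: X j) &
    strictly_better goods (value R goods i (X i)) (value R goods i P.1) /\
    strictly_better goods (value R goods i (X i)) (value R goods i P.2).
Proof.
case=> disjX coverX.
have ownerP (x : 'I_9) : {i | x \in X i}.
  apply: sigW; have: x \in \bigcup_(i < 3) X i by rewrite coverX inE.
  by case/bigcupP=> i _ xi; exists i.
pose owner x := sval (ownerP x).
have ownerE x i : (x \in X i) = (owner x == i).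
  apply/idP/eqP => [xi|<-]; last exact: (svalP (ownerP x)).
  apply/eqP; apply: contraLR xi => ne; have := disjX _ _ ne.
  by rewrite disjoint_subset => /subsetP/(_ x (svalP (ownerP x))).
pose l := [seq val (owner x) | x <- enum 'I_9].
have ownsE (x : 'I_9) (i : 'I_3) : owns l i x = (x \in X i).
  by rewrite /owns (nth_map x) ?size_enum_ord // nth_ord_enum ownerE.
have szl : size l = 9%N by rewrite size_map size_enum_ord.
have l3 : all (ltn^~ 3) l by apply/allP=> _ /mapP[x _ ->]; apply: ltn_ord.
have := all_wordsP (all_blocked goods) szl l3.
rewrite /blocked some_has => /hasP[[i j] ijin]; rewrite some_has.
case/hasP=> D _; rewrite /improves; case: ifP => //= b1 b2.
(* The search ranges over natural numbers; its six explicit pairs supply the bounds needed for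
   agents in ['I_3]. *)
have /and3P[i3 j3 ij] : [&& (i < 3)%N, (j < 3)%N & i != j].
  by move: ijin; rewrite !inE => /or4P[|||/or3P[]] => /eqP[-> ->].
exists (Ordinal i3), (Ordinal j3); split=> //.
pose part b := [set x : 'I_9 | side l i j D b x].
exists (part true, part false).
  rewrite inE /=; apply/andP; split.
    apply/eqP/setP => x; rewrite !inE -!ownsE /side /=.
    by case: (owns l i x); case: (owns l j x); case: (_ \in D).
  rewrite disjoint_subset; apply/subsetP => x; rewrite !inE /side.
  by case: (owns l i x); case: (owns l j x); case: (_ \in D).
have val_part b : value R goods (Ordinal i3) (part b) =
    (N.to_nat (sum_weight goods i (side l i j D b)))%:R.
  by apply: value_sum_weight => x; rewrite inE.
have val_own : value R goods (Ordinal i3) (X (Ordinal i3)) =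
    (N.to_nat (sum_weight goods i (owns l i)))%:R.
  by apply: value_sum_weight => x; rewrite -ownsE.
rewrite /= !val_part val_own; move: b1 b2.
rewrite /better /strictly_better !ltr_nat.
by case: (goods) => /to_nat_lt -> /to_nat_lt ->.
Qed.

Theorem theorem3 (R : realType) :
  (exists (n : nat) (M : finType) (c : 'I_n -> {set M} -> R),
     additive_instance c /\
     ~ exists X : 'I_n -> {set M}, allocation X /\ PMMS_chores c X) /\
  (exists (n : nat) (M : finType) (v : 'I_n -> {set M} -> R),
     additive_instance v /\
     ~ exists X : 'I_n -> {set M}, allocation X /\ PMMS_goods v X).
Proof.
split.
- exists 3, 'I_9, (@value R false); split.
    by split=> // i; apply: value_additive.
  case=> X [allocX pmms].
  have [i [j [ij [P PU [/= lt1 lt2]]]]] := improving_bipartition R false allocX.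
  have := pmms i j ij; rewrite leNgt => /negP; apply.
  (* The minimum is at most its term at [P], where both costs are below that of [X i]. *)
  rewrite /minimax_share; apply: le_lt_trans (bigmin_le_cond _ _ PU) _.
  by rewrite gt_max lt1 lt2.
- exists 3, 'I_9, (@value R true); split.
    by split=> // i; apply: value_additive.
  case=> X [allocX pmms].
  have [i [j [ij [P PU [/= lt1 lt2]]]]] := improving_bipartition R true allocX.
  have := pmms i j ij; rewrite leNgt => /negP; apply.
  rewrite /maximin_share; apply: lt_le_trans (le_bigmax_cond _ _ PU).
  by rewrite lt_min lt1 lt2.
Qed.
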